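(* Let $\varepsilon>0$ and $\tau_{(K)}=\max\{\tau_1,\dots,\tau_K\}$. Then $$\mathbb{P}\left(\tau_{(K)}\le\varepsilon\right)=1+\mathbb{E}\left[e^{-A_0(\varepsilon)}\left(\prod_{i=1}^K\left(1-e^{-A_i(\varepsilon)}\right)-1\right)\right].$$
   Context: Let $(\Omega,\mathcal F,\mathbb P,\mathbb F)$ be a filtered probability space satisfying the usual conditions, carrying an $\mathbb R^d$-valued process $X=(X_t)_{t\ge 0}$ with right-continuous paths with left limits, and $K+1$ exponential random variables $Z_0,Z_1,\dots,Z_K$ of parameter $1$, independent of each other and of $X$. For $i=0,1,\dots,K$ let $\alpha_i:\mathbb R^d\to[0,\infty)$ be a non-random, positive, continuous function, and put $A_i(s)=\int_0^s\alpha_i(X_r)\,dr$; assume $\lim_{s\to\infty}A_i(s)=\infty$. Define $\eta_i=\inf\{s: A_i(s)\ge Z_i\}$ for $i=0,\dots,K$, and the default times $\tau_i=\min(\eta_0,\eta_i)$ for $i=1,\dots,K$. *)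

(* Defs.v *)
From HB Require Import structures.
From mathcomp Require Import all_boot all_order all_algebra.
From mathcomp Require Import all_classical all_reals all_analysis.
Import Order.TTheory GRing.Theory Num.Theory.
Import numFieldNormedType.Exports.

Set Implicit Arguments.
Unset Strict Implicit.
Unset Printing Implicit Defensive.

Local Open Scope classical_set_scope.
Local Open Scope ring_scope.

(* Time is the half-line [0, +oo[; processes, paths and filtrations are
   functions on R of which only the values at t >= 0 are used. *)

Section filtration.
Context {d : measure_display} {T : measurableType d} {R : realType}.
Variables (P : probability T R) (F : R -> set_system T).

Definition is_filtration :=
  [/\ forall t, 0 <= t -> sigma_algebra setT (F t),
      forall t, 0 <= t -> F t `<=` measurable
    & forall s t, 0 <= s -> s <= t -> F s `<=` F t].

(* [P.-negligible N] says that N is included in a measurable null set, so the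
   last clause also forces the underlying probability space to be complete. *)
Definition usual_conditions :=
  [/\ is_filtration,
      forall t, 0 <= t -> \bigcap_(s in `]t, +oo[) F s = F t
    & P.-negligible `<=` F 0].

End filtration.

Section independence.
Context {d : measure_display} {T : measurableType d} {R : realType}.

Definition mutually_independent (P : probability T R) (I : finType)
    (G : I -> set_system T) :=
  forall (J : {set I}) (E : I -> set T),
    (forall i, i \in J -> G i (E i)) ->
    P (\bigcap_(i in [set` J]) E i) = (\prod_(i in J) P (E i))%E.

Definition rv_sigma (P : probability T R) (Z : {RV P >-> R}) : set_system T :=
  preimage_set_system setT Z measurable.

End independence.

Section process.
Context {R : realType} {n : nat}.

Definition borel_rV : set_system 'rV[R]_n := <<s @open 'rV[R]_n >>.

Definition random_process d (T : measurableType d) (X : R -> T -> 'rV[R]_n) :=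
  forall t, 0 <= t -> forall B, borel_rV B -> measurable (X t @^-1` B).

Definition process_sigma (T : Type) (X : R -> T -> 'rV[R]_n) : set_system T :=
  <<s [set E | exists t B, [/\ 0 <= t, borel_rV B & E = X t @^-1` B]] >>.

Definition cadlag (x : R -> 'rV[R]_n) :=
  (forall t, 0 <= t -> x s @[s --> t^'+] --> x t) /\
  (forall t, 0 < t -> cvg (x s @[s --> t^'-])).

Definition cumulated (a : 'rV[R]_n -> R) (x : R -> 'rV[R]_n) (s : R) : R :=
  \int[lebesgue_measure]_(r in `[0, s]) a (x r).

End process.

Section default_times.
Context {R : realType}.

(* Extended-real infimum, with value +oo when the level is never reached. *)
Definition first_passage (A : R -> R) (z : R) : \bar R :=
  ereal_inf [set s%:E | s in [set s : R | 0 <= s /\ z <= A s]].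

Context {n K : nat} {T : Type}.
Variables (alpha : 'I_K.+1 -> 'rV[R]_n -> R) (X : R -> T -> 'rV[R]_n).
Variable Z : 'I_K.+1 -> T -> R.

Definition A_ (i : 'I_K.+1) (s : R) (w : T) : R :=
  cumulated (alpha i) (X^~ w) s.

Definition eta_ (i : 'I_K.+1) (w : T) : \bar R :=
  first_passage (A_ i ^~ w) (Z i w).

(* The K names are indexed by 'I_K; [lift ord0 i] is the index i + 1 among
   0, ..., K, index ord0 being the common shock. *)
Definition tau_ (i : 'I_K) (w : T) : \bar R :=
  mine (eta_ ord0 w) (eta_ (lift ord0 i) w).

Definition tau_max (w : T) : \bar R := \big[maxe/-oo%E]_(i < K) tau_ i w.

End default_times.

(* Main.v *)
(* By right continuity and monotonicity of A_i, eta_i <= eps iff Z_i <= A_i(eps);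
   hence tau_(K) <= eps iff Z_0 <= A_0(eps), or Z_i <= A_i(eps) for all i >= 1.
   Conditionally on X these events are independent with probabilities
   1 - exp(- A_i(eps)), and inclusion-exclusion gives the formula.

   Instead of conditional expectations, the levels A_i(eps) are substituted one
   at a time for deterministic thresholds: if V has law Q and is independent of
   U under mu, then the integral of f(U, V) under mu is that of f(U, y) under
   mu \x Q. The A_i(eps) are measurable with respect to X because they are limits
   of Riemann sums along the cadlag paths. *)
Require Import Defs.
From HB Require Import structures.
From mathcomp Require Import all_boot all_order all_algebra.
From mathcomp Require Import ring lra.
From mathcomp Require Import all_classical all_reals all_analysis.
From mathcomp Require Import measurable_realfun.
Import Order.TTheory GRing.Theory Num.Theory.
Import numFieldNormedType.Exports.
Set Implicit Arguments.
Unset Strict Implicit.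
Unset Printing Implicit Defensive.
Local Open Scope classical_set_scope.
Local Open Scope ring_scope.

(** * Real cadlag functions and first passage of their integrals *)

Section cadlag_real.
Context {R : realType}.
Implicit Types (f : R -> R) (s r t C D M : R).
Notation mu := (@lebesgue_measure R).

Definition cadlagR f :=
  (forall t : R, 0 <= t -> f s @[s --> t^'+] --> f t) /\
  (forall t : R, 0 < t -> cvg (f s @[s --> t^'-])).

Lemma cadlagR_comp {n} (a : 'rV[R]_n -> R) (x : R -> 'rV[R]_n) :
  continuous a -> cadlag x -> cadlagR (a \o x).
Proof.
move=> ca [xr xl]; split => t t0.
  by apply: cvg_comp (xr t t0) _; exact: ca.
have /cvg_ex[l xll] := xl t t0.
by apply/cvg_ex; exists (a l); apply: cvg_comp xll _; exact: ca.
Qed.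

Lemma cvg_bounded_near f (G : set_system R) {FG : Filter G} (l : R) :
  f x @[x --> G] --> l -> \forall x \near G, `|f x| <= `|l| + 1.
Proof.
move=> fl; near=> x; near: x.
by apply: (cvgr_norm_le _ fl); rewrite ltrDl.
Unshelve. all: by end_near. Qed.

(** The right limit at [t] bounds [f] just after [t], and the left limit bounds it just before. The
    guard [0 <= x] discards negative times, where nothing is known about [f]. *)
Lemma cadlagR_locally_bounded f (t : R) : cadlagR f -> 0 <= t ->
  exists C : R, nbhs t [set x : R | 0 <= x -> `|f x| <= C].
Proof.
move=> [fr fl] t0.
have : \forall x \near t^'+, `|f x| <= `|f t| + 1 
  by exact: cvg_bounded_near (fr t t0).
rewrite near_withinE => hr.
have [D hl] : exists D : R, nbhs t [set x : R | 0 <= x -> x < t -> `|f x| <= D].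
  (* At [t = 0] no left limit is available, but no [x] satisfies both [0 <= x] and [x < t]. *)
  have [tle0|tgt0] := leP t 0.
    exists 0; apply: filterS hr => x _ /= x0.
    by rewrite ltNge (le_trans tle0).
  have /cvg_ex[l fl_] := fl t tgt0.
  have : \forall x \near t^'-, `|f x| <= `|l| + 1 
    by exact: cvg_bounded_near fl_.
  rewrite near_withinE => h; exists (`|l| + 1).
  by apply: filterS h => x h _; exact: h.
exists (Num.max (`|f t|) (Num.max (`|f t| + 1) D)).
apply: filterS2 hr hl => x hr hl x0.
rewrite !le_max; have [xt|xt|->] := ltgtP x t; last by rewrite lexx.
  by rewrite hl// !orbT.
by rewrite hr// !orbT.
Qed.

Lemma cadlagR_bounded f M : cadlagR f ->
  exists C : R, forall t : R, 0 <= t <= M -> `|f t| <= C.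
Proof.
move=> cf.
have cpt : compact `[0, M] by exact: segment_compact.
(* Compactness in near-covering form, with the bound [C] itself as the parameter tending to [+oo]:
   the local bounds merge into a uniform one. *)
have : \forall C \near +oo, `[0, M] `<=` (fun t => 0 <= t -> `|f t| <= C).
  move/compact_near_coveringP : cpt; apply => t.
  rewrite /= in_itv/= => /andP[t0 tM].
  have [C hC] := cadlagR_locally_bounded cf t0.
  exists ([set x | 0 <= x -> `|f x| <= C], [set D | C <= D]) => /=.
    by split => //; exists C; split; [exact: num_real|move=> D /ltW].
  by move=> [x D] [/= hx CD] x0; exact: le_trans (hx x0) CD.
case=> C [_ CP]; exists (C + 1) => t /andP[t0 tM].
by apply: (CP (C + 1)) => //; rewrite ?ltrDl//= in_itv/= t0.
Qed.

(** * Step functions and Riemann sums of cadlag functions *)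

Definition mesh (s : R) (n k : nat) : R := s * k%:R / n.+1%:R.

Definition cell (s : R) (n k : nat) : set R := `[mesh s n k, mesh s n k.+1[%classic.

(** Each cell carries the value of [f] at its right endpoint, so that the sample points approach [r]
    strictly from above, where right continuity applies. *)
Definition step f (s : R) (n : nat) (r : R) : R :=
  \sum_(k < n.+1) f (mesh s n k.+1) * \1_(cell s n k) r.

Lemma measurable_step f s n : measurable_fun setT (step f s n).
Proof.
apply: measurable_sum => k; apply: measurable_funM => //.
by apply: measurable_indic; exact: measurable_itv.
Qed.

Lemma mem_cell s n k r : 0 < s -> 0 <= r ->
  (r \in cell s n k) = (k == Num.truncn (r * n.+1%:R / s)).
Proof.
move=> s0 r0; rewrite mem_setE in_itv/= /mesh ler_pdivrMr// ltr_pdivlMr//.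
rewrite [s * _]mulrC [s * _]mulrC -ler_pdivlMr// -ltr_pdivrMr//.
apply/idP/eqP => [/truncn_def//|->].
by rewrite truncn_itv// divr_ge0 ?mulr_ge0// ltW.
Qed.

Lemma truncn_mesh_lt s n r : 0 < s -> 0 <= r < s ->
  (Num.truncn (r * n.+1%:R / s) < n.+1)%N.
Proof.
move=> s0 /andP[r0 rs].
rewrite -(ltr_nat R) (@le_lt_trans _ _ (r * n.+1%:R / s))//.
  by rewrite truncn_le divr_ge0 ?mulr_ge0// ltW.
by rewrite ltr_pdivrMr// mulrC ltr_pM2l.
Qed.

Lemma mesh_itv s n k : 0 < s -> (k <= n.+1)%N -> 0 <= mesh s n k <= s.
Proof.
move=> s0 kn; rewrite /mesh divr_ge0 ?mulr_ge0 ?(ltW s0)//=.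
by rewrite ler_pdivrMr// ler_pM2l// ler_nat.
Qed.

Lemma stepE f s n r : 0 < s -> 0 <= r < s ->
  step f s n r = f (mesh s n (Num.truncn (r * n.+1%:R / s)).+1).
Proof.
move=> s0 rs; have r0 : 0 <= r by case/andP: rs.
have kn := truncn_mesh_lt n s0 rs; set k := Num.truncn _ in kn *.
rewrite /step (bigD1 (Ordinal kn))//= indicE mem_cell// eqxx mulr1.
rewrite big1 ?addr0// => i ik; rewrite indicE mem_cell//.
by rewrite (negbTE (_ : i != k :> nat)) ?mulr0.
Qed.

Lemma step_cvg f s r : (forall t : R, 0 <= t -> f x @[x --> t^'+] --> f t) ->
  0 < s -> 0 <= r < s -> step f s n r @[n --> \oo] --> f r.
Proof.
move=> fr s0 /andP[r0 rs].
under eq_cvg do rewrite stepE ?r0//.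
apply: cvg_comp (fr r r0).
pose p n := mesh s n (Num.truncn (r * n.+1%:R / s)).+1.
have plb n : r < p n <= r + s / n.+1%:R.
  have := @truncn_itv _ (r * n.+1%:R / s).
  rewrite divr_ge0 ?mulr_ge0 ?(ltW s0)// => /(_ isT).
  rewrite /p /mesh; set k := Num.truncn _ => /andP[kr rk].
  apply/andP; split; first by rewrite ltr_pdivlMr// -ltr_pdivrMl// [_^-1 * _]mulrC.
  rewrite ler_pdivrMr// mulrDl divfK// -natr1 mulrDr mulr1 lerD2r.
  by rewrite mulrC -ler_pdivlMr.
have pr : p n @[n --> \oo] --> r.
  apply: (@squeeze_cvgr _ _ _ _ (cst r) (fun n => r + s / n.+1%:R)).
  - by apply: nearW => n; have /andP[/ltW rp pr] := plb n; apply/andP.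
  - exact: cvg_cst.
  - rewrite -[X in _ --> X]addr0; apply: cvgD; first exact: cvg_cst.
    rewrite -[X in _ --> X](mulr0 s); apply: cvgM; first exact: cvg_cst.
    exact: cvg_harmonic.
(* Convergence of [p n] to [r] becomes convergence within the right neighbourhoods, because
   [r < p n] for every [n]. *)
move=> A rA; have /pr pA : nbhs r [set u | r < u -> A u] by exact: rA.
have {}pA : \forall n \near \oo, r < p n -> A (p n) by exact: pA.
rewrite /= /nbhs/=; apply: filterS pA => n; apply.
by have /andP[] := plb n.
Qed.

Lemma right_continuous_measurable f s :
  (forall t : R, 0 <= t -> f x @[x --> t^'+] --> f t) ->
  0 < s -> measurable_fun `[0, s[ f.
Proof.
move=> fr s0; apply: (@measurable_fun_cvg _ _ _ _ (step f s)) => [n|r].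
  exact: measurable_funTS (measurable_step _ _ _).
by rewrite /= in_itv/=; exact: step_cvg.
Qed.

Lemma cadlagR_integrable f s : cadlagR f -> mu.-integrable `[0, s] (EFin \o f).
Proof.
move=> cf; apply: measurable_bounded_integrable => //.
- by rewrite /= lebesgue_measure_itv/=; case: ifPn; rewrite ?ltry.
- have [|s0] := ltP s 0.
    by move=> s0; rewrite set_itv_ge ?bnd_simp -?ltNge//; exact: measurable_fun_set0.
  (* Measurability was obtained on half-open intervals; enlarging to [[0, s + 1[] covers the
     endpoint [s]. *)
  apply: (@measurable_funS _ _ _ _ `[0, s + 1[) => //.
    by apply: subset_itvl; rewrite bnd_simp ltrDl.
  by apply: right_continuous_measurable; [case: cf|rewrite ltr_wpDl].
- have [C fC] := cadlagR_bounded s cf.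
  exists C; split; first exact: num_real.
  move=> D CD r /=; rewrite in_itv/= => rs.
  by rewrite (le_trans (fC _ rs))// ltW.
Qed.

(** Dominated convergence for the step functions, with the bound of [f] on [[0, s]] as dominating
    constant. Each sum involves [f] at finitely many times, which later gives measurability in the
    path. *)
Lemma riemann_cvg f s : cadlagR f -> (forall r, 0 <= f r) -> 0 < s ->
  (\sum_(k < n.+1) (f (mesh s n k.+1))%:E * mu (cell s n k `&` `[0%R, s[))%E
    @[n --> \oo] --> (\int[mu]_(r in `[0%R, s]) (f r)%:E)%E.
Proof.
move=> cf f0 s0.
have mI : measurable (`[0, s[%classic : set R) by exact: measurable_itv.
have mf := right_continuous_measurable cf.1 s0.
(* The point [s] lies in none of the cells used by [step]; being a null set, it is dropped. *)
rewrite -integral_itv_bndo_bndc; last exact/measurable_EFinP.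
have [C fC] := cadlagR_bounded s cf.
have cvgI : (\int[mu]_(r in `[0%R, s[) (step f s n r)%:E)%E
    @[n --> \oo] --> (\int[mu]_(r in `[0%R, s[) (f r)%:E)%E.
  apply: (@dominated_cvg _ _ _ mu _ mI (fun n r => (step f s n r)%:E)
    (EFin \o f) (cst C%:E)) => //.
  - move=> n; apply/measurable_EFinP.
    exact: measurable_funTS (measurable_step _ _ _).
  - move=> r; rewrite /= in_itv/= => rs; apply: cvg_EFin; first exact: nearW.
    exact: step_cvg cf.1 s0 rs.
  - apply: measurable_bounded_integrable => //; last first.
      exact: bounded_cst.
    by rewrite /= lebesgue_measure_itv/=; case: ifPn; rewrite ?ltry.
  - move=> n r; rewrite /= in_itv/= => rs.
    rewrite lee_fin stepE//; apply: fC.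
    by apply: mesh_itv => //; exact: truncn_mesh_lt.
apply: cvg_trans cvgI; apply: near_eq_cvg; apply: nearW => n.
under eq_integral do rewrite /step -sumEFin.
rewrite ge0_integral_sum//; last 2 first.
- move=> k; apply/measurable_EFinP; apply: measurable_funM => //.
  by apply: measurable_indic; exact: measurable_itv.
- by move=> k r _; rewrite lee_fin mulr_ge0.
apply: eq_bigr => k _; under eq_integral do rewrite EFinM.
rewrite ge0_integralZl_EFin//.
- by rewrite integral_indic//; exact: measurable_itv.
- apply/measurable_EFinP.
  by apply: measurable_indic; exact: measurable_itv.
Qed.

(** * Growth of the integral and first passage *)

Lemma lebesgue_measure_itvoc s t : s <= t -> mu `]s, t] = (t - s)%:E.
Proof.
rewrite lebesgue_measure_itv/= lte_fin le_eqVlt => /predU1P[->|->//].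
by rewrite ltxx subrr.
Qed.

Lemma Rintegral_cadlagR_le f s t : cadlagR f -> (forall r, 0 <= f r) ->
  0 <= s <= t -> \int[mu]_(r in `[0, s]) f r <= \int[mu]_(r in `[0, t]) f r.
Proof.
move=> cf f0 /andP[s0 st]; rewrite -subr_ge0 Rintegral_itvB ?bnd_simp//.
  by apply: Rintegral_ge0.
exact: cadlagR_integrable.
Qed.

Lemma Rintegral_cadlagR_lip f M : cadlagR f -> exists C, 0 < C /\
  forall s t, 0 <= s <= t -> t <= M ->
  \int[mu]_(r in `[0, t]) f r <= \int[mu]_(r in `[0, s]) f r + C * (t - s).
Proof.
move=> cf; have [C fC] := cadlagR_bounded M cf.
(* The maximum with 1 makes the Lipschitz constant positive, so that it can serve as a divisor. *)
exists (Num.max C 1); split; first by rewrite lt_max ltr01 orbT.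
move=> s t /andP[s0 st] tM.
rewrite -lerBlDl Rintegral_itvB ?bnd_simp//; last exact: cadlagR_integrable.
have mI : measurable (`]s, t]%classic : set R) by exact: measurable_itv.
have -> : Num.max C 1 * (t - s) = \int[mu]_(r in `]s, t]) (Num.max C 1).
  by rewrite Rintegral_cst//= lebesgue_measure_itvoc.
apply: le_Rintegral => //.
- apply: integrableS (cadlagR_integrable t cf) => //.
  by apply: subset_itvr; rewrite bnd_simp.
- apply: measurable_bounded_integrable => //; last exact: bounded_cst.
  by rewrite /= lebesgue_measure_itv/=; case: ifPn; rewrite ?ltry.
- move=> r /=; rewrite in_itv/= => /andP[sr rt].
  rewrite le_max (le_trans (ler_norm _))// fC//.
  by rewrite (le_trans s0 (ltW sr)) (le_trans rt).
Qed.

(** If the integral is still below [z] at time [s], the Lipschitz bound keeps it below [z] until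
    some [s + e], so the infimum exceeds [s]. Conversely, [s] itself belongs to the set. *)
Lemma first_passage_le f s (z : R) : cadlagR f -> (forall r, 0 <= f r) -> 0 <= s ->
  (first_passage (fun t => \int[mu]_(r in `[0, t]) f r)%R z <= s%:E)%E =
  (z <= \int[mu]_(r in `[0, s]) f r).
Proof.
move=> cf f0 s0; apply/idP/idP => [|zs]; last first.
  by apply: ereal_inf_lbound; exists s.
apply: contraTT; rewrite -!ltNge => zs.
have [C [C0 lipC]] := Rintegral_cadlagR_lip (s + 1) cf.
set I := fun t => _ in lipC zs *.
(* The bound 1 keeps [s + e] in the range where [C] is valid; the other bound limits the growth of
   the integral to half the gap [z - I s]. *)
pose e := Num.min 1 ((z - I s) / (2 * C)).
have e0 : 0 < e by rewrite lt_min ltr01 divr_gt0 ?mulr_gt0 ?subr_gt0.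
apply: (@lt_le_trans _ _ (s + e)%:E); first by rewrite lte_fin ltrDl.
apply: le_ereal_inf_tmp => _ [t [t0 zt] <-]; rewrite lee_fin leNgt; apply/negP => ts.
have : I t <= I (s + e).
  by apply: Rintegral_cadlagR_le => //; rewrite t0 ltW.
apply/negP; rewrite -ltNge (lt_le_trans _ zt)//.
apply: (@le_lt_trans _ _ (I s + C * (s + e - s))).
  apply: lipC; first by rewrite s0 lerDl ltW.
  by rewrite lerD2l ge_min lexx.
rewrite addrAC subrr add0r -ltrBrDl.
apply: (@le_lt_trans _ _ (C * ((z - I s) / (2 * C)))).
  by rewrite ler_pM2l// ge_min lexx orbT.
have -> : C * ((z - I s) / (2 * C)) = (z - I s) / 2.
  by field; rewrite gt_eqF.
by move: zs; rewrite -subr_gt0; set u := z - I s; lra.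
Qed.

End cadlag_real.

(** * Measurability of the cumulated intensities *)

Lemma borel_rV_preimage {R : realType} {n} (a : 'rV[R]_n -> R) (B : set R) :
  continuous a -> measurable B -> borel_rV (a @^-1` B).
Proof.
move=> ca mB.
have ma : measurable_fun setT (a : g_sigma_algebraType (@open 'rV[R]_n) -> R).
  apply: (measurability _ (RGenOInfty.measurableE R)) => _ [_ [x ->] <-].
  apply: sub_sigma_algebra; rewrite setTI.
  by apply: open_comp => [? _|]; [exact: ca|exact: interval_open].
by have := ma measurableT B mB; rewrite setTI.
Qed.

(** The generators of [process_sigma X], named so that [T] with the sigma-algebra of [X] can be
    formed as a measurable type. *)
Definition process_gen {R : realType} {n} (T : Type) (X : R -> T -> 'rV[R]_n) :=
  [set E | exists t B, [/\ 0 <= t, borel_rV B & E = X t @^-1` B]].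

Section cumulated_measurable.
Context {d : measure_display} {T : measurableType d} {R : realType}.
Context {n : nat}.
Variables (X : R -> T -> 'rV[R]_n) (a : 'rV[R]_n -> R).
Hypotheses (cX : forall w, cadlag (X^~ w)) (ca : continuous a).
Hypothesis a0 : forall x, 0 <= a x.
Let GT := g_sigma_algebraType (process_gen X).

(** Each Riemann sum depends on [X] at finitely many nonnegative times, hence is measurable for the
    sigma-algebra of [X]; so is the pointwise limit. *)
Lemma measurable_cumulated s : 0 < s ->
  measurable_fun setT (fun w : GT => cumulated a (X^~ w) s).
Proof.
move=> s0; apply: (@measurableT_comp _ _ _ _ _ _ (@fine R)) => //.
pose F m (w : GT) : \bar R :=
  (\sum_(k < m.+1) (a (X (mesh s m k.+1) w))%:E *
     lebesgue_measure (cell s m k `&` `[0%R, s[))%E.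
apply: (@emeasurable_fun_cvg _ _ _ _ F) => [m|w _].
  apply: emeasurable_sum => k; apply: emeasurable_funM => //.
  apply/measurable_EFinP => _ B mB; rewrite setTI; apply: sub_sigma_algebra.
  exists (mesh s m k.+1), (a @^-1` B); split => //.
    by have /andP[] := @mesh_itv _ s m k.+1 s0 (ltn_ord k).
  exact: borel_rV_preimage.
exact: (riemann_cvg (cadlagR_comp ca (cX w)) (fun=> a0 _) s0).
Qed.

End cumulated_measurable.

(** * Distribution function of the exponential law *)

Lemma exponential_prob_cdf {R : realType} (r x : R) : 0 <= x ->
  exponential_prob r `]-oo, x] = (1 - (expR (- r * x))%:E)%E.
Proof.
move=> x0.
have -> : exponential_prob r `]-oo, x] = exponential_prob r `[0, x].
  rewrite /exponential_prob integral_mkcond [RHS]integral_mkcond.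
  apply: eq_integral => y _; rewrite !patchE !mem_setE !in_itv/=.
  case: (ltP y 0) => y0/=; last by [].
  by rewrite lt0_exponential_pdf//; case: ifP.
move: x0; rewrite le_eqVlt => /predU1P[<-|]; last exact: exponential_prob_itv0c.
by rewrite set_itv1 /exponential_prob integral_set1 mulr0 expR0 subee.
Qed.

(** * Substituting random levels *)

Section random_levels.
Local Open Scope ereal_scope.

Lemma ge0_integral_mrestr {d} {T : measurableType d} {R : realType}
    (mu : {measure set T -> \bar R}) (C : set T) (mC : measurable C)
    (f : T -> \bar R) : measurable_fun setT f -> (forall x, 0 <= f x) ->
  \int[mrestr mu mC]_x f x = \int[mu]_(x in C) f x.
Proof.
move=> mf f0.
rewrite (@ge0_negligible_integral _ _ _ (mrestr mu mC) setT (~` C))//; last 2 first.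
- exact: measurableC.
- by rewrite /= /mrestr setICl measure0.
rewrite setTD setCK; apply: eq_measure_integral => A mA AC.
by rewrite /= /mrestr setIidl.
Qed.

(** * Replacing one independent variable by its law *)

Section freezing.
Context {d d1 d2 : measure_display} {T : measurableType d}.
Context {T1 : measurableType d1} {T2 : measurableType d2} {R : realType}.
Variables (mu : {finite_measure set T -> \bar R}) (Q : probability T2 R).
Variables (U : {mfun T >-> T1}) (V : {mfun T >-> T2}).
Hypothesis indep : forall A B, measurable A -> measurable B ->
  mu (U @^-1` A `&` V @^-1` B) = mu (U @^-1` A) * Q B.

Let mU := pushforward mu U.
Let mU_fin : fin_num_fun mU.
Proof. by move=> A mA; apply: fin_num_measure; exact: measurable_funPTI. Qed.
Let mU0 : mU set0 = 0. Proof. exact: measure0. Qed.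
Let mU_ge0 A : 0 <= mU A. Proof. exact: measure_ge0. Qed.
Let mU_sigma_additive : semi_sigma_additive mU.
Proof. exact: measure_semi_sigma_additive. Qed.
HB.instance Definition _ := isMeasure.Build _ _ _ mU mU0 mU_ge0 mU_sigma_additive.
HB.instance Definition _ := @Measure_isFinite.Build _ _ _ mU mU_fin.

(** By uniqueness of product measures, [indep] says that [(U, V)] has image measure [mU \x Q];
    Tonelli then integrates out the second variable. The measure [mu] is merely finite so that it
    can be the restriction of a probability to an event. *)
Lemma integral_freezing (f : T1 * T2 -> \bar R) :
  measurable_fun setT f -> (forall z, 0 <= f z) ->
  \int[mu]_w f (U w, V w) = \int[mu]_w \int[Q]_y f (U w, y).
Proof.
move=> mf f0.
have mUV : measurable_fun setT (fun w => (U w, V w)).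
  by apply: measurable_fun_pair.
pose UV w := (U w, V w).
transitivity (\int[pushforward mu UV]_z f z).
  by rewrite ge0_integral_pushforward.
rewrite (eq_measure_integral (mU \x Q)); last first.
  by move=> A mA _; apply/esym; exact: product_measure_unique.
rewrite fubini_tonelli1// /mU ge0_integral_pushforward//.
  exact: measurable_fun_fubini_tonelli_F.
by move=> x _; apply: integral_ge0.
Qed.

End freezing.

(** * Replacing all levels by induction *)

Section independent_levels.
Context {d d1 : measure_display} {T : measurableType d} {T1 : measurableType d1}.
Context {R : realType} {L : finType}.
Variables (P : probability T R) (U : {mfun T >-> T1}) (Z : L -> {RV P >-> R}).
Variables (A p : L -> T1 -> R).
Hypothesis mA : forall i, measurable_fun setT (A i).
Hypothesis mp : forall i, measurable_fun setT (p i).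
Hypothesis cdfE : forall i u,
  distribution P (Z i) `]-oo, A i u] = (p i u)%:E.
Hypothesis indep : forall (B : set T1) (E : L -> set T), measurable B ->
  (forall i, rv_sigma (Z i) (E i)) ->
  P (U @^-1` B `&` \bigcap_(i in [set: L]) E i) =
  P (U @^-1` B) * \prod_(i : L) P (E i).

Let below i : set T := [set w | (Z i w <= A i (U w))%R].

(* The levels substituted so far are those in J; the other events are arbitrary,
   which is what lets the induction on #|J| go through. *)
Definition mixed (J : {set L}) (E : L -> set T) : set T :=
  \bigcap_(i in [set: L]) (if i \in J then below i else E i).

Let p_ge0 i u : (0 <= p i u)%R.
Proof. by rewrite -lee_fin -cdfE. Qed.

Lemma measurable_level i : measurable (below i).
Proof.
have mAU : measurable_fun setT (fun w => A i (U w)) by exact: measurableT_comp.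
have : measurable_fun setT (fun w => (Z i w <= A i (U w))%R).
  exact: measurable_fun_ler.
by move=> /(_ measurableT [set true]); rewrite setTI; exact.
Qed.

Lemma rv_sigma_measurable i E : rv_sigma (Z i) E -> measurable E.
Proof. by move=> [B mB <-]; exact: measurable_funP. Qed.

Lemma measurable_mixed J E : (forall i, rv_sigma (Z i) (E i)) ->
  measurable (mixed J E).
Proof.
move=> mE; apply: fin_bigcap_measurable => [|i _]; first exact: finite_finset.
case: ifP => _; [exact: measurable_level|exact: rv_sigma_measurable (mE i)].
Qed.

(** Base case of the induction: by independence, restricting [P] to the intersection of the [E i]
    multiplies the image measure of [U] by the constant [c]. *)
Lemma integral_mixed0 E (Y : T1 -> \bar R) :
  (forall i, rv_sigma (Z i) (E i)) ->
  measurable_fun setT Y -> (forall u, 0 <= Y u) ->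
  \int[P]_(w in \bigcap_(i in [set: L]) E i) Y (U w) =
  \int[P]_w Y (U w) * \prod_(i : L) P (E i).
Proof.
move=> mE mY Y0; set C := \bigcap_(i in _) _; set c := \prod_(i : L) _.
have mC : measurable C.
  apply: fin_bigcap_measurable => [|i _]; first exact: finite_finset.
  exact: rv_sigma_measurable (mE i).
have mYU : measurable_fun setT (Y \o U) by exact: measurableT_comp.
have c0 : 0 <= c by apply: prode_ge0.
have cfin : c \is a fin_num.
  apply: prode_fin_num => i _; apply: fin_num_measure.
  exact: rv_sigma_measurable (mE i).
have c0' : (0 <= fine c)%R by exact: fine_ge0.
rewrite -(ge0_integral_mrestr P mC mYU); last by move=> w; exact: Y0.
transitivity (\int[pushforward (mrestr P mC) U]_u Y u).
  by rewrite ge0_integral_pushforward.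
rewrite (eq_measure_integral (mscale (NngNum c0') (pushforward P U))); last first.
  move=> B mB _; rewrite /= /mscale/= /pushforward /mrestr fineK//.
  by rewrite indep// muleC.
rewrite ge0_integral_mscale//= ge0_integral_pushforward// fineK//.
by rewrite muleC.
Qed.

(** Remove one index [k] from [J] and restrict [P] to the remaining events. There [Z k] is still
    independent of [U], by the induction hypothesis itself, so freezing turns the indicator of
    [below k] into the factor [p k (U w)]. This factor is absorbed into [Y], which is why [Y] is
    arbitrary, and the induction hypothesis applies once more. *)
Lemma integral_mixed (J : {set L}) E (Y : T1 -> \bar R) :
  (forall i, rv_sigma (Z i) (E i)) ->
  measurable_fun setT Y -> (forall u, 0 <= Y u) ->
  \int[P]_(w in mixed J E) Y (U w) =
  \int[P]_w (Y (U w) * (\prod_(i in J) p i (U w))%:E) *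
  \prod_(i | i \notin J) P (E i).
Proof.
move: {2}#|J| (erefl #|J|) => n; elim: n J E Y => [|n ih] J E Y.
  move=> /cards0_eq -> mE mY Y0.
  under [in RHS]eq_integral do rewrite big_set0 mule1.
  rewrite (_ : mixed _ _ = \bigcap_(i in [set: L]) E i); last first.
    by apply: eq_bigcapr => i _; rewrite inE.
  by rewrite integral_mixed0//; congr (_ * _); apply: eq_bigl => i; rewrite inE.
move=> Jn mE mY Y0.
have /card_gt0P[k kJ] : (0 < #|J|)%N by rewrite Jn.
pose J' := (J :\ k)%SET.
have J'n : #|J'| = n by apply/eqP; rewrite -eqSS -Jn (cardsD1 k J) kJ.
have kJ' : k \notin J' by rewrite !inE eqxx.
(* Slot [k] receives the event that [Z k] lies in [B]; taking [B = setT] lifts the constraint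
   there. *)
pose upd B i := if i == k then Z k @^-1` B else E i.
have mupd B : measurable B -> forall i, rv_sigma (Z i) (upd B i).
  by move=> mB i; rewrite /upd; case: eqVneq => // ->; exists B; rewrite ?setTI.
have updE B : \prod_(i | i \notin J') P (upd B i) =
    P (Z k @^-1` B) * \prod_(i | i \notin J) P (E i).
  rewrite (bigD1 k)//= /upd eqxx; congr (_ * _).
  apply: eq_big => i; first by rewrite !inE; case: eqVneq => [->|_]; rewrite ?kJ ?andbT.
  by move=> /andP[_ ik]; rewrite (negPf ik).
pose C B := mixed J' (upd B).
have mixed_upd B : C B = C setT `&` Z k @^-1` B.
  apply/seteqP; split => [w Cw|w [Cw kw] i _].
    split => [i _|]; last by have := Cw k I; rewrite (negbTE kJ') /upd eqxx.
    by have := Cw i I; case: ifP => // _; rewrite /upd; case: eqP.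
  by have := Cw i I; case: ifP => // _; rewrite /upd; case: eqP.
have mC : measurable (C setT) by apply: measurable_mixed; exact: mupd.
have Coo : P (C setT) < +oo by rewrite (le_lt_trans (probability_le1 P mC)) ?ltry.
have PC B H : measurable B -> measurable H -> P (U @^-1` H `&` C B) =
    \int[P]_w ((\1_H (U w))%:E * (\prod_(i in J') p i (U w))%:E) *
    (P (Z k @^-1` B) * \prod_(i | i \notin J) P (E i)).
  move=> mB mH.
  have mCB : measurable (C B) by apply: measurable_mixed; exact: mupd.
  have mUH : measurable (U @^-1` H) by exact: measurable_funPTI.
  rewrite -updE -(ih J' (upd B) (fun u => (\1_H u)%:E))//.
  - by rewrite -(integral_indic P mCB mUH).
  - exact: mupd.
  - by apply/measurable_EFinP; exact: measurable_indic.
have mixedE : mixed J E = C setT `&` below k.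
  apply/seteqP; split => [w Jw|w [Cw kw] i _].
    split => [i _|]; last by have := Jw k I; rewrite kJ.
    have := Jw i I; rewrite /upd !inE; case: eqVneq => [->//|_/=].
    by case: ifP.
  have := Cw i I; rewrite /upd !inE; case: eqVneq => [->|_/=]; first by rewrite kJ.
  by case: ifP.
pose g (z : T1 * R) := Y z.1 * (\1_[set z : T1 * R | (z.2 <= A k z.1)%R] z)%:E.
have mg : measurable_fun setT g.
  apply: emeasurable_funM; first exact: measurableT_comp.
  apply/measurable_EFinP/measurable_indic.
  have : measurable_fun setT (fun z : T1 * R => (z.2 <= A k z.1)%R).
    by apply: measurable_fun_ler => //; exact: measurableT_comp.
  by move=> /(_ measurableT [set true]); rewrite setTI; exact.
have g0 z : 0 <= g z by rewrite mule_ge0.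
pose mu : {finite_measure set T -> \bar R} := mfrestr mC Coo.
have mgUZ : measurable_fun setT (fun w => g (U w, Z k w)).
  by apply: measurableT_comp => //; exact: measurable_fun_pair.
transitivity (\int[mu]_w g (U w, Z k w)).
  rewrite ge0_integral_mrestr// mixedE integral_mkcondr.
  apply: eq_integral => w _; rewrite patchE /g indicE/=.
  have -> : ((U w, Z k w) \in [set z : T1 * R | (z.2 <= A k z.1)%R]) = (w \in below k).
    by [].
  by case: (w \in below k); rewrite ?mule1 ?mule0.
rewrite (@integral_freezing _ _ _ _ _ _ _ mu (distribution P (Z k)) U (Z k))//;
  last first.
  (* Independence under the restricted measure: [PC] evaluates both sides, at [B] and at [setT]. *)
  move=> H B mH mB; rewrite /= /mfrestr /mrestr.
  rewrite -setIA [_ `&` C _]setIC -mixed_upd !PC//.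
  by rewrite preimage_setT probability_setT mul1e -muleA; congr (_ * _); rewrite muleC.
have gE u : \int[distribution P (Z k)]_y g (u, y) = Y u * (p k u)%:E.
  rewrite /g /= ge0_integralZl//; last first.
    apply/measurable_EFinP.
    exact: (@measurable_indic _ _ _ setT `]-oo, A k u]%classic).
  rewrite -cdfE; congr (_ * _).
  rewrite -[in RHS](setIT `]-oo, A k u]%classic) -integral_indic//.
under eq_integral do rewrite gE.
have mYp : measurable_fun setT (fun u => Y u * (p k u)%:E).
  by apply: emeasurable_funM => //; exact/measurable_EFinP.
have Yp0 u : 0 <= Y u * (p k u)%:E by rewrite mule_ge0// lee_fin.
rewrite ge0_integral_mrestr//; last exact: measurableT_comp mYp _.
(* Second use of the induction hypothesis, with [p k] absorbed into the integrand. *)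
rewrite (ih J' (upd setT) (fun u => Y u * (p k u)%:E))//; last exact: mupd.
rewrite updE preimage_setT probability_setT mul1e; congr (_ * _).
apply: eq_integral => w _; rewrite -muleA -EFinM; congr (_ * _%:E).
by rewrite [RHS](big_setD1 k).
Qed.

Lemma probability_levels (J : {set L}) :
  P (\bigcap_(i in [set` J]) [set w | (Z i w <= A i (U w))%R]) =
  'E_P[fun w => (\prod_(i in J) p i (U w))%R].
Proof.
have mT i : rv_sigma (Z i) setT by exists setT; rewrite ?setTI.
rewrite expectation.unlock.
have -> : \bigcap_(i in [set` J]) [set w | (Z i w <= A i (U w))%R] =
    mixed J (fun=> setT).
  apply/seteqP; split => [w Jw i _|w Jw i /= iJ].
    by case: ifPn => // iJ; exact: Jw.
  by have := Jw i I; rewrite iJ.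
have -> : P (mixed J (fun=> setT)) = \int[P]_(w in mixed J (fun=> setT)) cst 1 (U w).
  by rewrite integral_cst ?mul1e//; exact: measurable_mixed.
rewrite integral_mixed//.
under eq_integral do rewrite mul1e.
by rewrite big1 ?mule1// => i _; rewrite probability_setT.
Qed.

End independent_levels.

End random_levels.

(** * Default times *)

(** Serves to separate the factor of [X], indexed by [None], from those of the [Z i] in the
    independence hypothesis. *)
Lemma big_option {S : Type} (idx : S) (op : Monoid.com_law idx) (I : finType)
    (F : option I -> S) :
  \big[op/idx]_(o : option I) F o = op (F None) (\big[op/idx]_i F (Some i)).
Proof.
rewrite (bigD1 None)//=; congr (op _ _).
rewrite (@reindex_omap _ _ _ _ _ Some id)/=; last by case.
by apply: eq_bigl => i; rewrite eqxx.
Qed.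

Section default_times.
Context {disp : measure_display} {T : measurableType disp} {R : realType}.
Variables (P : probability T R) (d K : nat) (X : R -> T -> 'rV[R]_d).
Variables (Z : 'I_K.+1 -> {RV P >-> R}) (alpha : 'I_K.+1 -> 'rV[R]_d -> R).
Variable eps : R.
Hypothesis pX : random_process X.
Hypothesis cX : forall w, cadlag (X^~ w).
Hypothesis expZ : forall i (B : set R), measurable B ->
  distribution P (Z i) B = exponential_prob 1 B.
Hypothesis indep : mutually_independent P
  (fun k : option 'I_K.+1 =>
     if k is Some i then rv_sigma (Z i) else process_sigma X).
Hypothesis calpha : forall i, continuous (alpha i).
Hypothesis alpha0 : forall i x, 0 <= alpha i x.
Hypothesis eps0 : 0 < eps.

Lemma process_sigma_measurable : process_sigma X `<=` measurable.
Proof.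
apply: smallest_sub; first exact: sigma_algebra_measurable.
by move=> _ [t [B [t0 mB ->]]]; exact: pX.
Qed.

Lemma eta_le i w :
  (eta_ alpha X Z i w <= eps%:E)%E = (Z i w <= A_ alpha X i eps w).
Proof.
apply: (first_passage_le (f := fun r => alpha i (X r w))) => //.
- exact: cadlagR_comp.
- exact: ltW.
Qed.

Let below i : set T := [set w | Z i w <= A_ alpha X i eps w].

(** The alternative involving [Z ord0] is the same for every name, so it can be taken out of the
    conjunction over the names. *)
Lemma tau_max_le : [set w | (tau_max alpha X Z w <= eps%:E)%E] =
  below ord0 `|` \bigcap_(i in [set` [set~ ord0]%SET]) below i.
Proof.
have tauE i w : (tau_ alpha X Z i w <= eps%:E)%E =
    (Z ord0 w <= A_ alpha X ord0 eps w) ||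
    (Z (lift ord0 i) w <= A_ alpha X (lift ord0 i) eps w).
  by rewrite /tau_ ge_min !eta_le.
apply/seteqP; split => w /=.
  move=> /bigmax_leP[_ h].
  have [Z0|/negP Z0] := boolP (Z ord0 w <= A_ alpha X ord0 eps w); first by left.
  right => i /=; rewrite !inE => i0.
  have [j ->|ij] := unliftP ord0 i; last by rewrite ij eqxx in i0.
  by have := h j isT; rewrite tauE => /orP[].
move=> w0; apply/bigmax_leP; split => [|i _]; first exact: leNye.
rewrite tauE; case: w0 => [->//|h]; apply/orP; right.
by apply: h; rewrite /= !inE.
Qed.

Lemma indep_process (B : set T) (E : 'I_K.+1 -> set T) : process_sigma X B ->
  (forall i, rv_sigma (Z i) (E i)) ->
  P (B `&` \bigcap_(i in [set: 'I_K.+1]) E i) = (P B * \prod_i P (E i))%E.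
Proof.
move=> mB mE.
have := @indep [set: option 'I_K.+1]%SET (fun o => if o is Some i then E i else B).
under eq_bigl do rewrite inE.
rewrite big_option => <-; last by case.
congr (P _); apply/seteqP; split => w.
  by move=> [Bw Ew] [i|] _ //; exact: Ew.
move=> h; split; first by have := h None; apply; rewrite /= inE.
by move=> i _; have := h (Some i); apply; rewrite /= inE.
Qed.

Lemma A_ge0 i w : 0 <= A_ alpha X i eps w.
Proof. by apply: Rintegral_ge0. Qed.

Lemma probability_hit (J : {set 'I_K.+1}) :
  P (\bigcap_(i in [set` J]) below i) =
  ('E_P[fun w => (\prod_(i in J) (1 - expR (- A_ alpha X i eps w)))%R])%E.
Proof.
pose GT := g_sigma_algebraType (process_gen X).
(* The variable [U] is the identity onto [T] with the sigma-algebra of [X]: its measurable preimages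
   are exactly the events of the process. *)
have mU : measurable_fun setT (id : T -> GT).
  by move=> _ B mB; rewrite setTI; exact: process_sigma_measurable.
pose U : {mfun T >-> GT} := HB.pack (id : T -> GT) (isMeasurableFun.Build _ _ _ _ _ mU).
pose A i : GT -> R := A_ alpha X i eps.
have mA i : measurable_fun setT (A i) by exact: measurable_cumulated.
apply: (@probability_levels _ _ _ _ _ _ P U Z A (fun i u => 1 - expR (- A i u))) => //.
- move=> i; apply: measurable_funB => //.
  by apply: measurableT_comp => //; exact: measurableT_comp.
- move=> i u; rewrite expZ// exponential_prob_cdf ?mulN1r//.
  exact: A_ge0.
- by move=> B E mB mE; exact: indep_process.
Qed.

Lemma measurable_A_ i : measurable_fun setT (A_ alpha X i eps).
Proof.
move=> _ B mB; rewrite setTI; apply: process_sigma_measurable.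
have := measurable_cumulated cX (@calpha i) (@alpha0 i) eps0.
by move=> /(_ measurableT B mB); rewrite setTI.
Qed.

Lemma measurable_below i : measurable (below i).
Proof.
have : measurable_fun setT (fun w => Z i w <= A_ alpha X i eps w).
  by apply: measurable_fun_ler => //; exact: measurable_A_.
by move=> /(_ measurableT [set true]); rewrite setTI; exact.
Qed.

(** All factors lie in [[0, 1]] because the cumulated intensities are nonnegative, so the product is
    bounded by 1. *)
Lemma integrable_hit (J : {set 'I_K.+1}) : P.-integrable setT
  (EFin \o (fun w => \prod_(i in J) (1 - expR (- A_ alpha X i eps w)))).
Proof.
apply: measurable_bounded_integrable => //.
- by rewrite [ltLHS]probability_setT ltry.
- under eq_fun do rewrite -big_enum/=.
  apply: measurable_prod => i _; apply: measurable_funB => //.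
  by apply: measurableT_comp => //; apply: measurableT_comp => //; exact: measurable_A_.
exists 1; split; first exact: num_real.
move=> M M1 w _ /=; rewrite (le_trans _ (ltW M1))//.
rewrite normr_prod; apply: prodr_ile1 => i _.
by rewrite normr_ge0/= ger0_norm ?subr_ge0 ?expR_le1 ?oppr_le0 ?A_ge0//.
Qed.

Lemma probability_tau_max_le :
  P [set w | (tau_max alpha X Z w <= eps%:E)%E] =
  (1 + 'E_P[fun w => (expR (- A_ alpha X ord0 eps w) *
              (\prod_(i < K) (1 - expR (- A_ alpha X (lift ord0 i) eps w))
               - 1))%R])%E.
Proof.
pose q (J : {set 'I_K.+1}) w : R := \prod_(i in J) (1 - expR (- A_ alpha X i eps w)).
pose O := [set ord0 : 'I_K.+1]%SET.
have mI (J : {set 'I_K.+1}) : measurable (\bigcap_(i in [set` J]) below i).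
  by apply: fin_bigcap_measurable => // i _; exact: measurable_below.
have PE (J : {set 'I_K.+1}) :
    P (\bigcap_(i in [set` J]) below i) = (\int[P]_w (q J w)%:E)%E.
  by rewrite probability_hit expectation.unlock.
have belowE : below ord0 = \bigcap_(i in [set` O]) below i.
  apply/seteqP; split => [w w0 i|w]; first by rewrite /= inE => /eqP ->.
  by apply; rewrite /= inE.
have capE : \bigcap_(i in [set` O]) below i `&`
    \bigcap_(i in [set` (~: O)%SET]) below i =
    \bigcap_(i in [set` [set: 'I_K.+1]%SET]) below i.
  apply/seteqP; split => [w [wO wC] i _|w wT].
    by have [iO|iO] := boolP (i \in O); [exact: wO|apply: wC; rewrite /= inE].
  by split=> i _; apply: wT; rewrite /= inE.
have qOE w : q O w = 1 - expR (- A_ alpha X ord0 eps w) by rewrite /q big_set1.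
have qCE w : q (~: O)%SET w =
    \prod_(i < K) (1 - expR (- A_ alpha X (lift ord0 i) eps w)).
  rewrite /q big_mkcond big_ord_recl /O !inE eqxx /= mul1r.
  by apply: eq_bigr => i _; rewrite !inE.
have qTE w : q [set: 'I_K.+1]%SET w = q O w * q (~: O)%SET w.
  rewrite qOE qCE /q big_mkcond big_ord_recl inE; congr (_ * _).
  by apply: eq_bigr => i _; rewrite inE.
rewrite tau_max_le belowE.
(* Inclusion-exclusion for the common shock and the joint idiosyncratic event; their intersection is
   the event over all indices. *)
transitivity (P (\bigcap_(i in [set` O]) below i) +
    P (\bigcap_(i in [set` (~: O)%SET]) below i) -
    P (\bigcap_(i in [set` [set: 'I_K.+1]%SET]) below i))%E.
  rewrite -capE; apply: measureUfinl => //.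
  by rewrite (le_lt_trans (probability_le1 P (mI _))) ?ltry.
rewrite !PE expectation.unlock.
(* With [q O = 1 - e] and [q (~: O) = c], this is [e * (c - 1) = (q O + c) - (q O * c + 1)]; the
   final 1 cancels the leading 1 of the formula. *)
under [in RHS]eq_integral => w _.
  have -> : expR (- A_ alpha X ord0 eps w) *
      (\prod_(i < K) (1 - expR (- A_ alpha X (lift ord0 i) eps w)) - 1) =
      (q O w + q (~: O)%SET w) - (q [set: 'I_K.+1]%SET w + 1).
    by rewrite qTE -qCE qOE; ring.
  over.
have i1 : P.-integrable setT (EFin \o (fun=> 1 : R)).
  exact: finite_measure_integrable_cst.
rewrite integralB_EFin//; last 2 first.
- exact: integrableD (integrable_hit _) (integrable_hit _).
- exact: integrableD (integrable_hit _) i1.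
rewrite !integralD_EFin//; try exact: integrable_hit.
have -> : (\int[P]_x (EFin \o (fun=> 1%R : R)) x = 1)%E.
  by rewrite -[RHS](probability_setT P) -[RHS]mul1e -integral_cst.
(* Finiteness moves the remaining identity from the extended reals to [R], where [ring] applies. *)
have fin (J : {set 'I_K.+1}) : (\int[P]_w (q J w)%:E)%E \is a fin_num.
  by rewrite -PE fin_num_measure.
rewrite -(fineK (fin O)) -(fineK (fin (~: O)%SET)) -(fineK (fin [set: 'I_K.+1]%SET)).
by rewrite -!(EFinD, EFinB); congr EFin; ring.
Qed.

End default_times.

Theorem theorem11 (R : realType) (disp : measure_display)
    (T : measurableType disp) (P : probability T R)
    (F : R -> set_system T) (d K : nat)
    (X : R -> T -> 'rV[R]_d)
    (Z : 'I_K.+1 -> {RV P >-> R})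
    (alpha : 'I_K.+1 -> 'rV[R]_d -> R) (eps : R) :
  (0 < d)%N -> (0 < K)%N ->
  usual_conditions P F ->
  random_process X ->
  (forall w, cadlag (X^~ w)) ->
  (forall i (B : set R), measurable B ->
     distribution P (Z i) B = exponential_prob 1 B) ->
  mutually_independent P
    (fun k : option 'I_K.+1 =>
       if k is Some i then rv_sigma (Z i) else process_sigma X) ->
  (forall i, continuous (alpha i)) ->
  (forall i x, 0 <= alpha i x) ->
  (forall i, {ae P, forall w, A_ alpha X i s w @[s --> +oo] --> +oo}) ->
  0 < eps ->
  P [set w | (tau_max alpha X Z w <= eps%:E)%E] =
  (1 + 'E_P[fun w => (expR (- A_ alpha X ord0 eps w) *
              (\prod_(i < K) (1 - expR (- A_ alpha X (lift ord0 i) eps w))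
               - 1))%R])%E.
Proof.
move=> _ _ _ pX cX expZ indep calpha alpha0 _ eps0.
exact: probability_tau_max_le.
Qed.
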